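(* Let $w>0$, and let $A\in\mathbb{R}^{r\times m}$, $\Lambda=\mathrm{diag}(\lambda_1,\dots,\lambda_r)$ with $\lambda_1\ge\cdots\ge\lambda_r>0$, $\mathbf{b}\in\mathbb{R}^m$ and $b_0\in\mathbb{R}$ be as defined in the context. Assume that $\lambda_1,\dots,\lambda_r$ are not all equal, and let $\lambda_k$ be the second smallest eigenvalue, that is, the smallest of the $\lambda_i$ with $\lambda_k>\lambda_r$, where $k$ is the largest index with this property. Let $\Lambda_k=\mathrm{diag}(\lambda_1,\dots,\lambda_k)$ and $\widehat{\mathbf{b}}:=A\mathbf{b}\in\mathbb{R}^r$. Consider the hard case $\lambda^*=-2w\lambda_r$ of the optimality (KKT) conditions given in the context, that is, the system in the unknowns $\mathbf{x}^*\in\mathbb{R}^r$, $y^*\in\mathbb{R}$: $$(\Lambda-\lambda_rI_r)\mathbf{x}^*=A\mathbf{b},\qquad y^*=b_0-w\lambda_r,\qquad y^*=\|\mathbf{x}^*\|^2 .$$ (i) (Necessity) If $(\mathbf{x}^*,y^* )$ satisfies this system, then $$\mathbf{x}^*_{[1:k]}=(\Lambda_k-\lambda_rI_k)^{-1}\widehat{\mathbf{b}}_{[1:k]},\qquad \widehat{\mathbf{b}}_{[(k+1):r]}=0,\qquad y^*=b_0-w\lambda_r>0,\qquad y^*\ge\|\mathbf{x}^*_{[1:k]}\|^2 .$$ (ii) (Sufficiency) Conversely, suppose that these four conditions hold, for $\mathbf{x}^*_{[1:k]}\in\mathbb{R}^k$ and $y^*\in\mathbb{R}$ defined by the stated formulas.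 Then, setting $x^*_{k+1}=\sqrt{y^*-\|\mathbf{x}^*_{[1:k]}\|^2}$ and $x^*_i=0$ for $i>k+1$, the resulting $(\mathbf{x}^*,y^* )$ satisfies the KKT conditions in the context with $\lambda^*=-2w\lambda_r$.
   Context: Notation: $\|\cdot\|$ is the Euclidean norm, $\mathbf{1}_m$ the all-ones column vector of length $m$, $I_n$ the $n\times n$ identity, $J_m:=I_m-\frac1m\mathbf{1}_m\mathbf{1}_m^\top$. For a vector $\mathbf{v}$, $\mathbf{v}_{[p:q]}$ is the subvector of its components $p,\dots,q$. Data: anchors $\mathbf{x}_1,\dots,\mathbf{x}_m\in\mathbb{R}^r$ and measurements $\boldsymbol{\delta}\in\mathbb{R}^m$. Let $D_{ij}=\|\mathbf{x}_i-\mathbf{x}_j\|^2$ and $B:=-\frac12J_mDJ_m$, which is positive semidefinite and is assumed (standing assumption) to have rank $r$. Let $B=U_r\Lambda U_r^\top$ be a spectral decomposition, where $\Lambda=\mathrm{diag}(\lambda_1,\dots,\lambda_r)$ with $\lambda_1\ge\cdots\ge\lambda_r>0$ the positive eigenvalues of $B$, and the columns of $U_r\in\mathbb{R}^{m\times r}$ are corresponding orthonormal eigenvectors. Let $A:=\Lambda^{1/2}U_r^\top=[\mathbf{a}_1,\dots,\mathbf{a}_m]\in\mathbb{R}^{r\times m}$. Set $\boldsymbol{\delta}_0:=\frac1mD\mathbf{1}_m$, $\ \mathbf{b}:=\frac12J_m(\boldsymbol{\delta}_0-\boldsymbol{\delta})\in\mathbb{R}^m$, $\ b_0:=\frac1m\mathbf{1}_m^\top\boldsymbol{\delta}-\frac{1}{2m^2}\mathbf{1}_m^\top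 D\mathbf{1}_m\in\mathbb{R}$. The optimality (KKT) conditions for the weighted problem $\min_{\mathbf{x}}\frac12(\|\mathbf{x}\|^2-b_0)^2+w\sum_{i=1}^m(\langle\mathbf{a}_i,\mathbf{x}\rangle-b_i)^2$, written with $y=\|\mathbf{x}\|^2$ and a multiplier $\lambda^*\in\mathbb{R}$, are: $(\Lambda+\frac{1}{2w}\lambda^*I_r)\mathbf{x}^*=A\mathbf{b}$, $\ y^*=b_0+\frac12\lambda^*$, $\ \lambda^*\ge-2w\lambda_r$, $\ y^*=\|\mathbf{x}^*\|^2$. The case $\lambda^*=-2w\lambda_r$ is called the hard case.
   Formalization: In (i) the strict inequality y* > 0 fails when x* = 0 (possible, e.g. when b = 0 and b_0 = wλ_r); the formal statement asserts y* ≥ 0 always and y* > 0 whenever x* ≠ 0, with everything else as stated. *)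

(* Defs.v *)
From mathcomp Require Import all_boot all_order all_algebra.

Set Implicit Arguments.
Unset Strict Implicit.
Unset Printing Implicit Defensive.

Import Order.TTheory GRing.Theory Num.Theory.
Local Open Scope ring_scope.

(* R ranges over real closed fields (the reals being one): only field         *)
(* operations, the order and square roots occur.                              *)
(* Indices are 0-based, and r is written n.+1, so that the index of lambda_r  *)
(* is ord_max.  An index k : 'I_n.+1 stands for the 1-based index k.+1; the   *)
(* vectors of its leading components have length k.+1.                        *)

Definition enorm (R : rcfType) (n : nat) (v : 'cV[R]_n) : R :=
  Num.sqrt (\sum_i v i 0 ^+ 2).

Definition ones (R : rcfType) (m : nat) : 'cV[R]_m := const_mx 1.

Definition centering (R : rcfType) (m : nat) : 'M[R]_m :=
  1%:M - m%:R^-1 *: (ones R m *m (ones R m)^T).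

Section Data.
Variables (R : rcfType) (m r : nat).
Variables (x : 'I_m -> 'cV[R]_r) (delta : 'cV[R]_m).

Definition sqdist : 'M[R]_m := \matrix_(i, j) enorm (x i - x j) ^+ 2.

Definition gram : 'M[R]_m :=
  - 2^-1 *: (centering R m *m sqdist *m centering R m).

Definition delta0 : 'cV[R]_m := m%:R^-1 *: (sqdist *m ones R m).

Definition bvec : 'cV[R]_m := 2^-1 *: (centering R m *m (delta0 - delta)).

Definition bzero : R :=
  m%:R^-1 * ((ones R m)^T *m delta) 0 0
  - (2 * m%:R ^+ 2)^-1 * ((ones R m)^T *m sqdist *m ones R m) 0 0.

End Data.

(* Thin spectral decomposition B = U Lambda U^T along the positive            *)
(* eigenvalues, listed with multiplicity in nonincreasing order.              *)
Definition spectral_decomposition (R : rcfType) (m r : nat)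
    (B : 'M[R]_m) (U : 'M[R]_(m, r)) (lam : 'rV[R]_r) : Prop :=
  [/\ B = U *m diag_mx lam *m U^T,
      U^T *m U = 1%:M,
      forall j, B *m col j U = lam 0 j *: col j U,
      forall i j : 'I_r, (i <= j)%N -> lam 0 j <= lam 0 i
    & forall i, 0 < lam 0 i].

Definition Amat (R : rcfType) (m r : nat)
    (U : 'M[R]_(m, r)) (lam : 'rV[R]_r) : 'M[R]_(r, m) :=
  diag_mx (map_mx Num.sqrt lam) *m U^T.

Section HardCase.
Variables (R : rcfType) (n : nat).
Implicit Types (lam : 'rV[R]_n.+1) (v : 'cV[R]_n.+1) (k : 'I_n.+1).

Definition lam_min lam : R := lam 0 ord_max.

(* lam 0 k is the smallest entry above the last one, and k is the largest     *)
(* index of an entry above the last one.                                      *)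
Definition second_smallest_index lam k : Prop :=
  lam_min lam < lam 0 k /\
  forall i, lam_min lam < lam 0 i -> lam 0 k <= lam 0 i /\ (i <= k)%N.

Definition leading k v : 'cV[R]_k.+1 := rowsub (widen_ord (ltn_ord k)) v.

Definition leading_diag k lam : 'M[R]_k.+1 :=
  diag_mx (colsub (widen_ord (ltn_ord k)) lam).

Definition trailing_zero k v : Prop := forall i : 'I_n.+1, (k < i)%N -> v i 0 = 0.

(* The vector (xk, s, 0, ..., 0). *)
Definition extend k (xk : 'cV[R]_k.+1) (s : R) : 'cV[R]_n.+1 :=
  \col_i if (i <= k)%N then xk (inord i) 0
         else if i == k.+1 :> nat then s else 0.

(* bhat stands for A b. *)
Definition KKT (w : R) lam (bhat : 'cV[R]_n.+1) (b0 : R)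
    (x : 'cV[R]_n.+1) (y mu : R) : Prop :=
  [/\ (diag_mx lam + ((2 * w)^-1 * mu)%:M) *m x = bhat,
      y = b0 + 2^-1 * mu,
      - 2 * w * lam_min lam <= mu
    & y = enorm x ^+ 2].

End HardCase.

(* Main.v *)
Require Import Defs.
From mathcomp Require Import all_boot all_order all_algebra.

Set Implicit Arguments.
Unset Strict Implicit.
Unset Printing Implicit Defensive.

Import Order.TTheory GRing.Theory Num.Theory.
Local Open Scope ring_scope.

(** The matrix [diag_mx lam - lr%:M] is diagonal, with positive entries up to index [k] and zeros
    beyond it. The linear system therefore splits: the leading block is invertible and determines
    [leading k x] ([leading_diag_subM_mul], [leading_diag_subM_unit]), while each trailing row reads
    [0 = bhat i 0] and leaves that coordinate of [x] free ([trailing_lam_min]). The norm equation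
    then only fixes the trailing mass as [y] minus the leading squared norm ([enorm_sqr_split]). So
    this difference is nonnegative, and conversely all of it can be put into the coordinate after
    [k] ([enorm_extend_sqr]). *)

Lemma enorm_sqr (R : rcfType) (n : nat) (v : 'cV[R]_n) :
  enorm v ^+ 2 = \sum_i v i 0 ^+ 2.
Proof. by rewrite sqr_sqrtr // sumr_ge0 // => i _; rewrite sqr_ge0. Qed.

Lemma enorm_sqr_eq0 (R : rcfType) (n : nat) (v : 'cV[R]_n) :
  (enorm v ^+ 2 == 0) = (v == 0).
Proof.
rewrite enorm_sqr; apply/eqP/eqP => [v0|->]; last first.
  by rewrite big1 // => i _; rewrite mxE expr0n.
apply/matrixP => i j; rewrite ord1 mxE; apply/eqP; rewrite -sqrf_eq0.
by apply/eqP; apply: (psumr_eq0P _ v0) => // l _; apply: sqr_ge0.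
Qed.

Lemma diag_subM_mulE (R : comPzRingType) (n : nat) (d : 'rV[R]_n) (c : R)
    (v : 'cV[R]_n) i :
  ((diag_mx d - c%:M) *m v) i 0 = (d 0 i - c) * v i 0.
Proof. by rewrite mulmxBl mul_diag_mx mul_scalar_mx !mxE mulrBl. Qed.

Section Leading.
Variables (R : rcfType) (n : nat) (k : 'I_n.+1).
Implicit Types (lam : 'rV[R]_n.+1) (v : 'cV[R]_n.+1) (u : 'cV[R]_k.+1).

Lemma leading_diag_subM_mul lam (c : R) v :
  leading k ((diag_mx lam - c%:M) *m v)
    = (leading_diag k lam - c%:M) *m leading k v.
Proof.
apply/matrixP => i j; rewrite ord1 {}/j diag_subM_mulE.
by rewrite [LHS]mxE diag_subM_mulE !mxE.
Qed.

Lemma eq_leading v v' :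
  leading k v = leading k v' ->
  (forall i : 'I_n.+1, (k < i)%N -> v i 0 = v' i 0) -> v = v'.
Proof.
move=> /matrixP vv' tl; apply/matrixP => i j; rewrite ord1 {}/j.
have [ki|ik] := ltnP k i; first exact: tl.
have := vv' (Ordinal (ik : (i < k.+1)%N)) 0; rewrite !mxE.
by congr (v _ _ = v' _ _); apply: val_inj.
Qed.

Lemma enorm_sqr_split v :
  enorm v ^+ 2 =
    enorm (leading k v) ^+ 2 + \sum_(i < n.+1 | (k < i)%N) v i 0 ^+ 2.
Proof.
rewrite !enorm_sqr (bigID (fun i : 'I_n.+1 => (i < k.+1)%N)) /=.
rewrite (big_ord_narrow (ltn_ord k)); congr (_ + _).
  by apply: eq_bigr => i _; rewrite mxE.
by apply: eq_bigl => i; rewrite -leqNgt.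
Qed.

Lemma leading_extend u (s : R) : leading k (extend u s) = u.
Proof.
apply/matrixP => i j; rewrite ord1 {}/j !mxE /= -ltnS ltn_ord.
by congr (u _ _); apply: val_inj; rewrite /= inordK.
Qed.

Lemma enorm_extend_sqr u (s : R) :
  (k < n)%N -> enorm (extend u s) ^+ 2 = enorm u ^+ 2 + s ^+ 2.
Proof.
move=> kn; rewrite enorm_sqr_split leading_extend; congr (_ + _).
(* The bound [k < n] makes [k.+1] a genuine index; it carries the only nonzero term of the tail. *)
rewrite (bigD1 (Ordinal (kn : (k.+1 < n.+1)%N))) //= mxE /= ltnn eqxx.
rewrite big1 ?addr0 // => i /andP[ki]; rewrite -val_eqE /= => /negbTE ik.
by rewrite mxE leqNgt ki ik expr0n.
Qed.

Section SecondSmallest.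
Variable lam : 'rV[R]_n.+1.
Hypothesis lam_noninc : forall i j : 'I_n.+1, (i <= j)%N -> lam 0 j <= lam 0 i.
Hypothesis kP : second_smallest_index lam k.

(** This guarantees a slot after [k] for the free coordinate: at [k = ord_max] the strict inequality
    on [lam 0 k] would compare an eigenvalue with itself. *)
Lemma second_smallest_index_ltn : (k < n)%N.
Proof.
have [lt_k _] := kP; rewrite ltn_neqAle -ltnS ltn_ord andbT.
apply: contraTneq lt_k => kn; rewrite /lam_min.
by have -> : k = ord_max by [apply: val_inj]; rewrite ltxx.
Qed.

(** Monotonicity gives one inequality; the maximality of [k] excludes a strict one. *)
Lemma trailing_lam_min (i : 'I_n.+1) : (k < i)%N -> lam 0 i = lam_min lam.
Proof.
move=> ki; apply/eqP; rewrite eq_le [X in _ && X]lam_noninc ?andbT; last first.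
  by rewrite -ltnS ltn_ord.
by rewrite leNgt; apply: contraTN ki => /kP.2[_]; rewrite -leqNgt.
Qed.

(** The determinant is a product of gaps, each at least [lam 0 k - lam_min lam], which is
    positive. *)
Lemma leading_diag_subM_unit :
  leading_diag k lam - (lam_min lam)%:M \in unitmx.
Proof.
rewrite /leading_diag -diag_const_mx -raddfB unitmxE det_diag unitfE.
apply/prodf_neq0 => i _; rewrite !mxE subr_eq0 gt_eqF //.
by apply: lt_le_trans kP.1 (lam_noninc _); rewrite /= -ltnS ltn_ord.
Qed.

End SecondSmallest.
End Leading.

Theorem mainTheorem3 (R : rcfType) (m n : nat)
    (anchor : 'I_m -> 'cV[R]_n.+1) (delta : 'cV[R]_m)
    (U : 'M[R]_(m, n.+1)) (lam : 'rV[R]_n.+1) (w : R) (k : 'I_n.+1) :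
  \rank (gram anchor) = n.+1 ->
  spectral_decomposition (gram anchor) U lam ->
  0 < w ->
  ~ (forall i j, lam 0 i = lam 0 j) ->
  second_smallest_index lam k ->
  let bhat : 'cV[R]_n.+1 := Amat U lam *m bvec anchor delta in
  let b0 : R := bzero anchor delta in
  let lr : R := lam_min lam in
  let sol_k : 'cV[R]_k.+1 :=
    invmx (leading_diag k lam - lr%:M) *m leading k bhat in
  (forall (x : 'cV[R]_n.+1) (y : R),
     (diag_mx lam - lr%:M) *m x = bhat ->
     y = b0 - w * lr ->
     y = enorm x ^+ 2 ->
     [/\ leading k x = sol_k,
         trailing_zero k bhat,
         y = b0 - w * lr,
         0 <= y /\ (x <> 0 -> 0 < y)
       & enorm (leading k x) ^+ 2 <= y])
  /\
  (forall (xk : 'cV[R]_k.+1) (y : R),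
     xk = sol_k ->
     trailing_zero k bhat ->
     y = b0 - w * lr ->
     0 < y ->
     enorm xk ^+ 2 <= y ->
     KKT w lam bhat b0
       (extend xk (Num.sqrt (y - enorm xk ^+ 2))) y (- 2 * w * lr)).
Proof.
move=> _ [_ _ _ lam_noninc _] w_gt0 _ kP bhat b0 lr sol_k.
have kn := second_smallest_index_ltn kP.
have unitM := leading_diag_subM_unit lam_noninc kP.
have trl := trailing_lam_min lam_noninc kP.
split=> [x y Ex Ey Eyx | xk y Exk b_tl Ey y_gt0 xk_le]; split=> //.
- by rewrite /sol_k -Ex leading_diag_subM_mul mulKmx.
- by move=> i ki; rewrite -Ex diag_subM_mulE trl // subrr mul0r.
(* As [y] is the squared norm of [x], it can vanish only at [x = 0]. *)
- rewrite Eyx sqr_ge0; split=> // /eqP x0.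
  by rewrite lt_def enorm_sqr_eq0 x0 sqr_ge0.
- rewrite Eyx (enorm_sqr_split k) lerDl.
  by apply: sumr_ge0 => i _; rewrite sqr_ge0.
(* The hard-case multiplier turns the KKT shift into [- lr], so the equation can be checked block by
   block; its bound on the multiplier is an equality. *)
- have -> : (2 * w)^-1 * (- 2 * w * lr) = - lr.
    by rewrite !mulNr mulrN mulKf // mulf_neq0 ?pnatr_eq0 ?gt_eqF.
  rewrite raddfN /=; apply: (eq_leading (k := k)) => [|i ki].
    by rewrite leading_diag_subM_mul leading_extend Exk mulKVmx.
  by rewrite diag_subM_mulE trl // subrr mul0r b_tl.
- by rewrite Ey !mulNr mulrN -mulrA mulKf ?pnatr_eq0.
- by rewrite enorm_extend_sqr // [X in _ + X]sqr_sqrtr ?subr_ge0 // addrC subrK.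
Qed.
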